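(* For every integer $n\ge 1$, the greedy algorithm $GR_0$ is optimal for instances of $\mathcal I_{n,0}$, and $\gamma^{\mathcal I_{n,0}}=\gamma^{\mathcal I_{n,0}}_{GR_0}=\frac1n$.
   Context: Problem (OPTiWinD on the segment): a vehicle starts at position $0$ at time $0$ and moves in $[-1,1]$ at speed at most $1$. A request is a triple $(A,[r,r+2],\delta)$ with location $A\in[-1,1]$, release time $r\ge0$ and weight $\delta>0$; it is served if the vehicle is at $A$ at some time in $[r,r+2]$. For an integer $n\ge1$ and $T\ge0$, $\mathcal I_{n,T}$ is the set of instances consisting of at most $n$ requests such that the release times of any two successive requests differ by at least $T$. An online algorithm learns each request (location and weight) only at its release time and does not know the number of requests in advance; its movement up to time $t$ depends only on the requests released up to time $t$. For an instance $I$ and algorithm $ALG$, the performance $\lambda^I_{ALG}$ is the total weight of served requests divided by the total weight of all requests; $OPT$ is the optimal offline algorithm (knowing the whole instance in advance). Define $\lambda^{\mathcal I_{n,T}}_{ALG}=\inf_{I\in\mathcal I_{n,T}}\lambda^I_{ALG}$, $\gamma^{\mathcal I_{n,T}}_{ALG}=\inf_{I\in\mathcal I_{n,T}}\lambda^I_{ALG}/\lambda^I_{OPT}$ (competitive ratio), $\lambda^{\mathcal I_{n,T}}=\sup_{ALG}\lambda^{\mathcal I_{n,T}}_{ALG}$ and $\gamma^{\mathcal I_{n,T}}=\sup_{ALG}\gamma^{\mathcal I_{n,T}}_{ALG}$, the suprema over online algorithms. An online algorithm is optimal if its competitive ratio equals $\gamma^{\mathcal I_{n,T}}$. The algorithm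 $GR_0$: the vehicle always moves at unit speed towards the request of greatest weight among the released, not yet served requests whose time window is still open (switching destination whenever a new request of greater weight appears). *)

(* Defs.v *)
From mathcomp Require Import all_boot all_order all_algebra.
From mathcomp Require Import boolp classical_sets reals.

Set Implicit Arguments.
Unset Strict Implicit.
Unset Printing Implicit Defensive.

Import Order.TTheory GRing.Theory Num.Theory.
Local Open Scope classical_set_scope.
Local Open Scope ring_scope.

Section Defs.
Variable R : realType.

(* The triple (A, r, d) stands for the request (A, [r, r + 2], d). *)
Definition request : Type := R * R * R.
Definition location (q : request) : R := q.1.1.
Definition release (q : request) : R := q.1.2.
Definition deadline (q : request) : R := release q + 2.
Definition weight (q : request) : R := q.2.

Definition valid_request (q : request) : bool :=
  [&& -1 <= location q, location q <= 1, 0 <= release q & 0 < weight q].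

(* Requests are listed in chronological order. *)
Definition spaced (T : R) (I : seq request) : bool :=
  sorted (fun p q : request => release p + T <= release q) I.

Definition instance : set (seq request) :=
  [set I | all valid_request I /\ spaced 0 I].

(* The empty instance is left out: its performance would be 0 / 0. *)
Definition instances (n : nat) (T : R) : set (seq request) :=
  [set I | [/\ instance I, spaced T I & (0 < size I <= n)%N]].

(* Only the values of a trajectory at nonnegative times are meaningful. *)
Definition trajectory : set (R -> R) :=
  [set x | [/\ x 0 = 0,
               forall t, 0 <= t -> -1 <= x t <= 1
             & forall s t, 0 <= s -> s <= t -> `|x t - x s| <= t - s]].

Definition served (x : R -> R) (q : request) : Prop :=
  exists2 t, release q <= t <= deadline q & x t = location q.

Definition performance (x : R -> R) (I : seq request) : R :=
  (\sum_(q <- I | `[< served x q >]) weight q) / (\sum_(q <- I) weight q).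

(* The supremum is attained, as only finitely many values occur. *)
Definition performance_OPT (I : seq request) : R :=
  sup [set performance x I | x in trajectory].

Definition algorithm : Type := seq request -> R -> R.

Definition released (t : R) (I : seq request) : seq request :=
  [seq q <- I | release q <= t].

Definition online : set algorithm :=
  [set ALG | (forall I, instance I -> trajectory (ALG I)) /\
    (forall I J t, instance I -> instance J -> released t I = released t J ->
       forall s, 0 <= s -> s <= t -> ALG I s = ALG J s)].

Definition competitive_ratio (n : nat) (T : R) (ALG : algorithm) : R :=
  inf [set performance (ALG I) I / performance_OPT I | I in instances n T].

Definition best_ratio (n : nat) (T : R) : R :=
  sup [set competitive_ratio n T ALG | ALG in online].

Definition optimal (n : nat) (T : R) (ALG : algorithm) : Prop :=
  online ALG /\ competitive_ratio n T ALG = best_ratio n T.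

(* The time t = deadline q is excluded: a request not served up to and
   including its deadline cannot influence the motion after it. *)
Definition pending (x : R -> R) (I : seq request) (t : R) (q : request) : Prop :=
  [/\ q \in I, release q <= t < deadline q
    & forall s, release q <= s <= t -> x s <> location q].

Definition heaviest (x : R -> R) (I : seq request) (t : R) (q : request) : Prop :=
  pending x I t q /\ forall p, pending x I t p -> weight p <= weight q.

(* Just after time t; the vehicle stands still if a = x t. *)
Definition heads_to (x : R -> R) (t a : R) : Prop :=
  exists2 e, 0 < e &
    forall s, t <= s <= t + e -> x s = x t + (s - t) * Num.sg (a - x t).

(* Ties between weights are broken arbitrarily, but by the last clause a
   destination is kept as long as it is pending and no pending request is
   strictly heavier.  The vehicle stands still when nothing is pending. *)
Definition greedy_motion (I : seq request) (x : R -> R) : Prop :=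
  exists dest : R -> request,
    [/\ forall t, 0 <= t -> (exists q, pending x I t q) ->
          heaviest x I t (dest t) /\ heads_to x t (location (dest t)),
        forall t, 0 <= t -> ~ (exists q, pending x I t q) -> heads_to x t (x t)
      & forall t s, 0 <= t -> t <= s ->
          (forall u, t <= u <= s -> heaviest x I u (dest t)) ->
          dest s = dest t].

(* ALG is the algorithm GR_0 for some tie-breaking rule. *)
Definition is_GR0 (ALG : algorithm) : Prop :=
  online ALG /\ forall I, instance I -> greedy_motion I (ALG I).

End Defs.

Arguments best_ratio : clear implicits.

(* Main.v *)
(* Lower bound.  When the earliest of the heaviest requests is released, the
   greedy vehicle heads for a request of maximal weight released at that very
   moment and keeps doing so; as [-1, 1] has length 2, it serves it in time.  It
   thus collects at least 1/n of the total weight.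

   Upper bound.  An adversary uses unit weights at the two ends of the segment.
   Whenever the vehicle is about to serve a request, another one appears at the
   opposite end, so close to that moment that the vehicle cannot serve both.
   After n requests it serves at most one, while a vehicle oscillating between
   the ends half a period ahead serves them all. *)
Require Import Defs.
From mathcomp Require Import all_boot all_order all_algebra.
From mathcomp Require Import boolp classical_sets reals.
From mathcomp Require Import lra.

Set Implicit Arguments.
Unset Strict Implicit.
Unset Printing Implicit Defensive.

Import Order.TTheory GRing.Theory Num.Theory.
Local Open Scope ring_scope.

(** * Trajectories *)

Section Trajectories.
Variable R : realType.
Implicit Types (x z : R -> R) (I J : seq (request R)) (p q : request R).

Definition agree x z (t : R) := forall s, 0 <= s <= t -> x s = z s.

Lemma trajectory_lip x s t : trajectory x -> 0 <= s -> s <= t ->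
  x t - x s <= t - s /\ x s - x t <= t - s.
Proof.
move=> [_ _ lip] s0 st; have := lip _ _ s0 st.
by rewrite ler_norml => /andP[]; lra.
Qed.

Lemma trajectory_bound x t : trajectory x -> 0 <= t -> -1 <= x t <= 1.
Proof. by move=> [_ b _]; exact: b. Qed.

(* Follow [x] up to time [t], then head for [a] at unit speed and stop there. *)
Definition steer x (t a : R) : R -> R := fun s =>
  if s <= t then x s else x t + Num.max (t - s) (Num.min (s - t) (a - x t)).

Lemma steer_agree x t a s : s <= t -> steer x t a s = x s.
Proof. by rewrite /steer => ->. Qed.

(** Moving left, arrived and moving right are the three linear regimes; splitting them reduces later
    facts on [steer] to linear arithmetic. *)
Lemma steer_cases x t a s : t <= s ->
  [\/ s - t <= x t - a /\ steer x t a s = x t - (s - t),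
      [/\ a - x t <= s - t, x t - a <= s - t & steer x t a s = a]
    | s - t <= a - x t /\ steer x t a s = x t + (s - t)].
Proof.
rewrite /steer; case: (leP s t) => [st|lts] ts.
  have -> : s = t by apply: le_anti; rewrite st.
  by case: (leP 0 (x t - a)) => h; [constructor 1|constructor 3]; split; lra.
rewrite /Num.max /Num.min; case: (ltP (s - t) (a - x t)) => h1.
  by constructor 3; case: ltP => ?; split; lra.
by case: ltP => h2; [constructor 2|constructor 1]; split; lra.
Qed.

Lemma steer_arrived x t a s : `|a - x t| <= s - t -> steer x t a s = a.
Proof.
move=> h; have ts : t <= s by have := normr_ge0 (a - x t); lra.
move: h; rewrite ler_norml => /andP[h1 h2].
by have [[? ->]|[]|[? ->]] := steer_cases x a ts; lra.
Qed.

Lemma steer_moving x t a s : t <= s -> s - t <= `|a - x t| ->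
  steer x t a s = x t + (s - t) * Num.sg (a - x t).
Proof.
move=> ts; have [lt|gt|e] := ltgtP a (x t).
- rewrite ltr0_sg ?ltr0_norm ?subr_lt0// => ?.
  by have [[? ->]|[? ? ->]|[? ->]] := steer_cases x a ts; lra.
- rewrite gtr0_sg ?gtr0_norm ?subr_gt0// => ?.
  by have [[? ->]|[? ? ->]|[? ->]] := steer_cases x a ts; lra.
- rewrite e subrr sgr0 normr0 => ?.
  by have [[? ->]|[]|[? ->]] := steer_cases x (x t) ts; lra.
Qed.

Lemma steer_trajectory x t a : trajectory x -> 0 <= t -> -1 <= a <= 1 ->
  trajectory (steer x t a).
Proof.
move=> tx t0 /andP[a1 a2]; have [x0 bx _] := tx; split.
- by rewrite steer_agree.
- move=> s s0; have [st|ts] := leP s t; first by rewrite steer_agree ?bx.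
  have /andP[b1 b2] := bx _ t0.
  by have [[? ->]|[? ? ->]|[? ->]] := steer_cases x a (ltW ts); lra.
have after u v : t <= u -> u <= v ->
    steer x t a v - steer x t a u <= v - u /\
    steer x t a u - steer x t a v <= v - u.
  move=> tu uv; have [[? ->]|[? ? ->]|[? ->]] := steer_cases x a tu;
  have [[? ->]|[? ? ->]|[? ->]] := steer_cases x a (le_trans tu uv); lra.
move=> s u s0 su; rewrite ler_norml; have [ut|tu] := leP u t.
  have := trajectory_lip tx s0 su.
  rewrite !steer_agree ?(le_trans su ut)//; lra.
have [st|ts] := leP s t; last by have := after s u (ltW ts) su; lra.
have := trajectory_lip tx s0 st; have := after t u (lexx t) (ltW tu).
by rewrite (steer_agree _ _ (lexx t)) (steer_agree _ _ st); lra.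
Qed.

Lemma agree_trans t x y z : agree x y t -> agree y z t -> agree x z t.
Proof. by move=> h h' s hs; rewrite h ?h'. Qed.

Lemma agreeC t x y : agree x y t -> agree y x t.
Proof. by move=> h s hs; rewrite h. Qed.

Lemma agreeW s t x y : s <= t -> agree x y t -> agree x y s.
Proof. by move=> st h u hu; apply: h; lra. Qed.

Lemma agree_closed x z t : trajectory x -> trajectory z ->
  (forall s, 0 <= s -> s < t -> x s = z s) -> agree x z t.
Proof.
move=> tx tz h s /andP[s0]; rewrite le_eqVlt => /orP[/eqP st|]; last exact: h.
have [->|s_neq0] := eqVneq s 0.
  by have [-> _ _] := tx; have [-> _ _] := tz.
have sp : 0 < s by rewrite lt_neqAle eq_sym s_neq0.
apply/eqP; rewrite -subr_eq0 -normr_le0; apply/ler_addgt0Pl => e e0.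
rewrite addr0; pose u := Num.max 0 (s - e / 2).
have [u0 us ue] : [/\ 0 <= u, u < s & s - u <= e / 2].
  by rewrite /u /Num.max; case: ltP; split; lra.
Abort.

(** Both motions are 1-Lipschitz, so agreement up to [u] lets them differ by at most [2 * (s - u)]
    at a later time [s]; [u] is taken within [e / 2] of [s]. *)
Lemma agree_closed x z t : trajectory x -> trajectory z ->
  (forall s, 0 <= s -> s < t -> x s = z s) -> agree x z t.
Proof.
move=> tx tz h s /andP[s0]; rewrite le_eqVlt => /orP[/eqP st|]; last exact: h.
have [->|s_neq0] := eqVneq s 0.
  by have [-> _ _] := tx; have [-> _ _] := tz.
apply/eqP; rewrite -subr_eq0 -normr_le0; apply/ler_addgt0Pl => e e0.
rewrite addr0; pose u := Num.max 0 (s - e / 2).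
have sp : 0 < s by rewrite lt_neqAle eq_sym s_neq0.
have [u0 us ue] : [/\ 0 <= u, u < s & s - u <= e / 2].
  by rewrite /u /Num.max; case: (ltP 0 (s - e / 2)) => ?; split; lra.
have [] := trajectory_lip tx u0 (ltW us); have [] := trajectory_lip tz u0 (ltW us).
by rewrite ler_norml -(h u) -?st//; lra.
Qed.

(** Continuity makes the set of visits after the release closed, so its infimum is attained. *)
Lemma first_service x q : trajectory x -> 0 <= release q -> served x q ->
  exists s, [/\ release q <= s <= deadline q, x s = location q
    & forall u, release q <= u < s -> x u <> location q].
Proof.
move=> tx r0 [s0 /andP[rs sd] xs0].
pose S := [set s | release q <= s /\ x s = location q]%classic.
have S0 : (S !=set0)%classic by exists s0.
have lbS : has_lbound S by exists (release q) => u [].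
have ri : release q <= inf S by apply: lb_le_inf => // u [].
have is0 : inf S <= s0 by apply: ge_inf.
exists (inf S); split; first by rewrite ri (le_trans is0).
  apply/eqP; rewrite -subr_eq0 -normr_le0; apply/ler_addgt0Pl => e e0.
  have [u [ru xu] ui] := inf_adherent e0 (conj S0 lbS).
  have iu : inf S <= u by apply: ge_inf.
  have [] := trajectory_lip tx (le_trans r0 ri) iu.
  by rewrite addr0 ler_norml xu; lra.
move=> u /andP[ru ui] xu.
by have := ge_inf lbS (conj ru xu : S u); rewrite leNgt ui.
Qed.

End Trajectories.

(** * Existence of the greedy algorithm *)

Lemma seq_argmax (R : realType) (T : eqType) (P : T -> Prop) (f : T -> R)
    (s : seq T) : (exists2 q, q \in s & P q) ->
  exists q, [/\ q \in s, P q & forall p, p \in s -> P p -> f p <= f q].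
Proof.
elim: s => [[]//|a s IH] [q].
have [[q' q's Pq'] _ _|none] := pselect (exists2 q, q \in s & P q).
  have [m [ms Pm mmax]] := IH (ex_intro2 _ _ q' q's Pq').
  have [Pa|nPa] := pselect (P a); last first.
    exists m; split => //; first by rewrite in_cons ms orbT.
    by move=> p; rewrite in_cons => /orP[/eqP->|/mmax].
  have [am|ma] := leP (f a) (f m).
    exists m; split => //; first by rewrite in_cons ms orbT.
    by move=> p; rewrite in_cons => /orP[/eqP->|/mmax].
  exists a; split => //; first exact: mem_head.
  move=> p; rewrite in_cons => /orP[/eqP->//|ps Pp].
  exact: le_trans (mmax _ ps Pp) (ltW ma).
rewrite in_cons => /orP[/eqP-> Pa|qs Pq]; last by case: none; exists q.
exists a; split => //; first exact: mem_head.
move=> p; rewrite in_cons => /orP[/eqP->//|ps Pp].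
by case: none; exists p.
Qed.

Lemma ltn_count (T : eqType) (a b : pred T) (s : seq T) (p : T) :
  {in s, forall q, a q -> b q} -> p \in s -> b p -> ~~ a p ->
  (count a s < count b s)%N.
Proof.
elim: s => //= c s IH sub; rewrite in_cons.
have sub' : {in s, forall q, a q -> b q}.
  by move=> q qs; apply: sub; rewrite in_cons qs orbT.
have le_ab : (count a s <= count b s)%N.
  elim: s sub' {IH sub} => //= d s IH sub; apply: leq_add.
    by case: (boolP (a d)) => // /(sub _ (mem_head _ _))->.
  by apply: IH => q qs; apply: sub; rewrite in_cons qs orbT.
move=> /orP[/eqP-> -> /negbTE-> //|ps bp nap].
rewrite -addnS leq_add ?IH//.
by case: (boolP (a c)) => // /(sub _ (mem_head _ _))->.
Qed.

(** Entries before the first one satisfying [a] fail [a] and are [r]-below it, hence fail [b] too.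
    This makes the tie-breaking of [best] stable in time. *)
Lemma head_filter_sorted (T : eqType) (r : rel T) (a b : pred T) (s : seq T) d :
  transitive r -> sorted r s -> has a s ->
  let p := head d (filter a s) in
  b p -> {in s, forall q, r q p -> b q -> a q} -> head d (filter b s) = p.
Proof.
move=> rt; elim: s => //= c s IH sc.
have [ac _ /= -> //|nac /= has_a bp sub] := boolP (a c).
have ps : head d (filter a s) \in s.
  have : filter a s != [::] by rewrite -has_filter.
  case E : (filter a s) => [//|e l] _ /=.
  by have := mem_head e l; rewrite -E mem_filter => /andP[].
have rc : r c (head d (filter a s)).
  by have /allP := order_path_min rt sc; apply.
have /negbTE-> : ~~ b c by apply: contra nac => /(sub _ (mem_head _ _) rc).
apply: IH (path_sorted sc) has_a bp _ => q qs.
by apply: sub; rewrite in_cons qs orbT.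
Qed.

Section Greedy.
Variable R : realType.
Implicit Types (x z : R -> R) (I J : seq (request R)) (p q : request R).

Lemma valid_release I q : instance I -> q \in I -> 0 <= release q.
Proof. by move=> [/allP v _] /v /and4P[]. Qed.

Lemma valid_location I q : instance I -> q \in I -> -1 <= location q <= 1.
Proof. by move=> [/allP v _] /v /and4P[-> ->]. Qed.

Lemma valid_weight I q : instance I -> q \in I -> 0 < weight q.
Proof. by move=> [/allP v _] /v /and4P[]. Qed.

(** The summand 0 makes this convertible to the relation inside [spaced 0]. *)
Definition release_le : rel (request R) := fun p q => release p + 0 <= release q.

Lemma release_le_trans : transitive release_le.
Proof. by move=> q p r; rewrite /release_le !addr0; exact: le_trans. Qed.

Lemma instance_rcons I q : instance (rcons I q) <->
  [/\ instance I, valid_request q & {in I, forall p, release p <= release q}].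
Proof.
rewrite /instance /= /spaced !(sorted_pairwise release_le_trans).
rewrite all_rcons pairwise_rcons; split.
  move=> [/andP[vq vI] /andP[/allP qI sI]]; split => // p /qI.
  by rewrite /= /release_le addr0.
move=> [[-> ->] -> h]; split => //; rewrite andbT.
by apply/allP => p /h; rewrite /= /release_le addr0.
Qed.

Lemma pending_agree x z I t q : instance I -> agree x z t ->
  pending x I t q -> pending z I t q.
Proof.
move=> hI xz [qI qt un]; split => // s /andP[qs st].
rewrite -xz; first by apply: un; rewrite qs.
by rewrite st (le_trans (valid_release hI qI)).
Qed.

Lemma pendingW x I s t q : release q <= s -> s <= t ->
  pending x I t q -> pending x I s q.
Proof.
move=> qs st [qI /andP[qt td] un]; split => //.
  by rewrite qs (le_lt_trans st).
by move=> u /andP[qu us]; apply: un; rewrite qu (le_trans us).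
Qed.

(* Ties are broken in favour of the earliest request of the list, so that a new
   request of equal weight does not divert the vehicle. *)
Definition best x I t : request R :=
  head (0, 0, 0) [seq q <- I | `[< heaviest x I t q >]].

Lemma best_heaviest x I t : (exists q, pending x I t q) ->
  heaviest x I t (best x I t).
Proof.
move=> [q pq]; have qI : q \in I by case: pq.
have [m [mI pm mmax]] := seq_argmax (@weight R) (ex_intro2 _ _ q qI pq).
have hm : heaviest x I t m.
  by split => // p pp; apply: mmax => //; case: pp.
rewrite /best; case E : [seq q <- I | _] => [|c s] /=.
  have : m \in [seq q <- I | `[< heaviest x I t q >]].
    by rewrite mem_filter mI andbT; exact/asboolP.
  by rewrite E.
have := mem_head c s; rewrite -E mem_filter => /andP[/asboolP].
by [].
Qed.

Lemma best_agree x z I t : instance I -> agree x z t ->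
  best x I t = best z I t.
Proof.
move=> hI xz; congr head; apply: eq_filter => q; apply: asbool_equiv_eq.
have zx := agreeC xz.
split=> -[pq h]; split; [exact: pending_agree pq| |exact: pending_agree pq|].
  by move=> p /(pending_agree hI zx); exact: h.
by move=> p /(pending_agree hI xz); exact: h.
Qed.

(** A request heaviest at [s] and released no later than [best x I t] was pending at [t] with at
    least the same weight, so it was heaviest at [t] as well and cannot precede [best x I t] in the
    list. *)
Lemma best_keep x I t s : instance I -> t <= s ->
  (exists q, pending x I t q) -> heaviest x I s (best x I t) ->
  best x I s = best x I t.
Proof.
move=> hI ts ext hs; have [pt ht] := best_heaviest ext.
apply: (head_filter_sorted release_le_trans).
- by case: hI.
- by apply/hasP; exists (best x I t); [case: pt|apply/asboolP].
- exact/asboolP.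
move=> q qI; rewrite /release_le addr0 => qp /asboolP[pq hq]; apply/asboolP.
have rt : release (best x I t) <= t by case: pt => _ /andP[].
split; first exact: pendingW (le_trans qp rt) ts pq.
by move=> r /ht /le_trans; apply; apply: hq; case: hs.
Qed.

(** The heading clauses of [greedy_motion] for the destination [best] are isolated at one time, so
    that motions can be glued; the last clause will come from [best_keep]. *)
Definition greedy_at x I t :=
  ((exists q, pending x I t q) -> heads_to x t (location (best x I t))) /\
  (~ (exists q, pending x I t q) -> heads_to x t (x t)).

Lemma steer_neq x t a s : t <= s -> s - t < `|a - x t| -> steer x t a s <> a.
Proof.
move=> ts; rewrite ltr_normr => /orP h.
by have [[? ->]|[? ? ->]|[? ->]] := steer_cases x a ts; case: h; lra.
Qed.

Lemma steer_step x t a s u : t <= s -> s <= u -> s < t + `|a - x t| ->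
  u <= t + `|a - x t| ->
  steer x t a u = steer x t a s + (u - s) * Num.sg (a - steer x t a s).
Proof.
move=> ts su; rewrite -!lerBlDl -!ltrBlDl => sd ud.
rewrite !steer_moving ?(ltW sd) ?(le_trans ts su)//.
have [lt|gt|e] := ltgtP a (x t).
- have d : `|a - x t| = x t - a by rewrite ltr0_norm ?subr_lt0 ?opprB.
  by rewrite (ltr0_sg (_ : a - x t < 0)) ?subr_lt0// ltr0_sg; lra.
- have d : `|a - x t| = a - x t by rewrite gtr0_norm ?subr_gt0.
  by rewrite (gtr0_sg (_ : 0 < a - x t)) ?subr_gt0// gtr0_sg; lra.
- by move: sd; rewrite e subrr normr0; lra.
Qed.

Lemma steer_heads_to x y t a s t1 :
  t <= s -> s < t1 -> t1 <= t + `|a - x t| ->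
  (forall u, t <= u <= t1 -> y u = steer x t a u) -> heads_to y s a.
Proof.
move=> ts st1 t1a yE; exists (t1 - s); first lra.
move=> u /andP[su ut]; rewrite !yE; [|lra|lra].
by apply: steer_step => //; lra.
Qed.

(* With no release to come, the motion is a finite sequence of straight moves:
   each ends when its target is reached or expires, which makes one pending
   request fewer. *)
Lemma greedy_run I t0 x0 : instance I -> 0 <= t0 ->
  {in I, forall q, release q <= t0} -> trajectory x0 ->
  exists x, [/\ trajectory x, agree x x0 t0
    & forall t, t0 <= t -> greedy_at x I t].
Proof.
move=> hI; have [m] := ubnP (count (fun q => `[< pending x0 I t0 q >]) I).
elim: m x0 t0 => // m IH x0 t0 cm t00 rel tx0.
(* With every request released by [t0], the pending set can only shrink. *)
have mono x t q : agree x x0 t0 -> t0 <= t -> pending x I t q ->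
    pending x0 I t0 q.
  move=> xx0 tt0 pq; apply: (pending_agree hI xx0).
  by apply: (pendingW _ tt0 pq); apply: rel; case: pq.
have [some|none] := pselect (exists q, pending x0 I t0 q); last first.
  exists (steer x0 t0 (x0 t0)).
  have ag : agree (steer x0 t0 (x0 t0)) x0 t0.
    by move=> s /andP[_ st]; rewrite steer_agree.
  have const s : t0 <= s -> steer x0 t0 (x0 t0) s = x0 t0.
    by move=> ts; rewrite steer_arrived ?subrr ?normr0 ?subr_ge0.
  split => //; first by apply: steer_trajectory => //; exact: trajectory_bound.
  move=> t tt0; split=> [[q pq]|_]; first by case: none; exists q; exact: mono pq.
  exists 1 => // s /andP[ts _].
  by rewrite subrr sgr0 mulr0 addr0 !const// (le_trans tt0).
set p := best x0 I t0; set a := location p; set y := x0 t0.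
have [pp hp] : heaviest x0 I t0 p by exact: best_heaviest.
have [pI /andP[rp dp] unp] := pp.
pose t1 := Num.min (t0 + `|a - y|) (deadline p).
have ya : y <> a by apply: unp; rewrite rp lexx.
have [t01 t1a t1d t1E] : [/\ t0 < t1, t1 <= t0 + `|a - y|, t1 <= deadline p
    & t1 = t0 + `|a - y| \/ t1 = deadline p].
  have : 0 < `|a - y| by rewrite normr_gt0 subr_eq0; apply/eqP => /esym.
  rewrite /t1; case: (leP (t0 + `|a - y|) (deadline p)) => ? ?.
    by split; [lra|lra|lra|left].
  by split; [lra|lra|lra|right].
set x1 := steer x0 t0 a.
have tx1 : trajectory x1.
  by apply: steer_trajectory => //; exact: valid_location pI.
have ag1 : agree x1 x0 t0 by move=> s /andP[_ st]; rewrite /x1 steer_agree.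
have t10 : 0 <= t1 by lra.
have rel1 : {in I, forall q, release q <= t1} by move=> q /rel; lra.
(* At [t1] either [p] has just been reached, or its deadline has come, which [pending] excludes. *)
have np1 : ~ pending x1 I t1 p.
  case=> _ /andP[r1 d1] un1; case: t1E => t1E; last by lra.
  apply: (un1 t1); first by rewrite r1 lexx.
  by rewrite /x1 steer_arrived// -/y t1E; lra.
have lt_c : (count (fun q => `[< pending x1 I t1 q >]) I < m)%N.
  rewrite ltnS in cm; apply: leq_trans cm; apply: (ltn_count _ pI).
  - by move=> q qI /asboolP pq; apply/asboolP; exact: mono (ltW t01) pq.
  - exact/asboolP.
  - exact/asboolPn.
have [x [tx xx1 gx]] := IH _ _ lt_c t10 rel1 tx1.
have xx0 : agree x x0 t0 by apply: agree_trans ag1; exact: agreeW (ltW t01) xx1.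
exists x; split => // t tt0; have [tt1|] := leP t1 t; first exact: gx.
(* Before [t1] the request [p] is still pending, and by [mono] nothing heavier has appeared, so
   [best] stays equal to [p]. *)
move=> tt1; have pt : pending x I t p.
  split => //; first by rewrite (le_trans rp)// (lt_le_trans tt1).
  move=> s /andP[rs st]; have s0 := le_trans (valid_release hI pI) rs.
  have [st0|ts0] := leP s t0.
    by rewrite xx0 ?s0//; apply: unp; rewrite rs.
  rewrite xx1; last by rewrite s0 (le_trans st)// ltW.
  apply: steer_neq; first exact: ltW.
  by rewrite -/y; lra.
have bt0 : best x I t0 = p by exact: best_agree.
have ht : heaviest x I t (best x I t0).
  by rewrite bt0; split => // q pq; apply: hp; exact: mono pq.
split=> [_|[]]; last by exists p.
rewrite (best_keep hI tt0 _ ht) ?bt0; last first.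
  by exists p; exact: pending_agree (agreeC xx0) pp.
apply: (steer_heads_to (x := x0) tt0 tt1 t1a) => u /andP[tu ut].
by rewrite xx1//; lra.
Qed.

(** Before its release [q] is not pending and [x0] remains greedy; from then on all requests are
    known and [greedy_run] applies. *)
Lemma greedy_extend I q x0 : instance (rcons I q) -> trajectory x0 ->
  (forall t, 0 <= t -> greedy_at x0 I t) ->
  exists x, [/\ trajectory x, agree x x0 (release q)
    & forall t, 0 <= t -> greedy_at x (rcons I q) t].
Proof.
move=> hIq tx0 g0; have /instance_rcons[hI /and4P[_ _ q0 _] le_q] := hIq.
have relq : {in rcons I q, forall p, release p <= release q}.
  by move=> p; rewrite mem_rcons in_cons => /orP[/eqP->//|/le_q].
have [x [tx xx0 gx]] := greedy_run hIq q0 relq tx0.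
exists x; split => // t t0; have [|tq] := leP (release q) t; first exact: gx.
have agt : agree x x0 t by exact: agreeW (ltW tq) xx0.
have pE p : pending x (rcons I q) t p <-> pending x0 I t p.
  split=> [pp|pp].
    have [+ /andP[rp dp] un] := pending_agree hIq agt pp.
    rewrite mem_rcons in_cons => /orP[/eqP pq|pI]; last by split => //; apply/andP.
    by move: rp; rewrite pq leNgt tq.
  have [pI rp un] := pending_agree hI (agreeC agt) pp.
  by split => //; rewrite mem_rcons in_cons pI orbT.
have hE p : heaviest x (rcons I q) t p <-> heaviest x0 I t p.
  by split=> -[/pE pp h]; split => // r /pE; exact: h.
have bE : best x (rcons I q) t = best x0 I t.
  congr head; rewrite filter_rcons; case: asboolP => [/hE[[_ /andP[]]]|_].
    by rewrite leNgt tq.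
  by apply: eq_filter => p; apply: asbool_equiv_eq.
have heads a : heads_to x0 t a -> heads_to x t a.
  (* The straight move is cut at [release q], after which [x] may leave [x0]. *)
  move=> [e e0 h]; exists (Num.min e (release q - t)).
    by rewrite lt_min e0 subr_gt0.
  move=> s /andP[ts]; rewrite -lerBlDl le_min => /andP[se sq].
  rewrite (xx0 s); last by lra.
  by rewrite (agt t) ?t0 ?lexx// h// ts -lerBlDl.
have [ga gb] := g0 t t0; split=> [[p /pE pp]|none].
  by rewrite bE; apply/heads/ga; exists p.
rewrite agt ?t0 ?lexx//; apply/heads/gb => -[p /pE pp].
by apply: none; exists p.
Qed.

Lemma trajectory_cst0 : trajectory (fun=> 0 : R).
Proof.
by split=> // [t _|s t _ st]; [rewrite lerN10 ler01|rewrite subrr normr0 subr_ge0].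
Qed.

(* [L] lists the requests latest first; adding a request keeps the motion up to
   its release, which makes the algorithm online. *)
Fixpoint greedy_rev (L : seq (request R)) : R -> R :=
  if L is q :: L' then
    xget (greedy_rev L') [set x | [/\ trajectory x,
      agree x (greedy_rev L') (release q)
      & forall t, 0 <= t -> greedy_at x (rcons (rev L') q) t]]%classic
  else fun=> 0.

Definition greedy (I : seq (request R)) : R -> R := greedy_rev (rev I).

Lemma greedy_nil t : greedy_at (greedy [::]) [::] t.
Proof.
split=> [[q []]//|_]; exists 1 => // s _.
by rewrite subrr sgr0 mulr0 addr0.
Qed.

Lemma greedyP I : instance I -> trajectory (greedy I) /\
  forall t, 0 <= t -> greedy_at (greedy I) I t.
Proof.
elim/last_ind: I => [_|I q IH hIq].
  by split; [exact: trajectory_cst0|move=> t _; exact: greedy_nil].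
have /instance_rcons[hI _ _] := hIq; have [tI gI] := IH hI.
have := xgetPex (greedy I) (greedy_extend hIq tI gI).
by rewrite /greedy rev_rcons /= revK => -[].
Qed.

Lemma greedy_rcons I q : instance (rcons I q) ->
  agree (greedy (rcons I q)) (greedy I) (release q).
Proof.
move=> hIq; have /instance_rcons[hI _ _] := hIq.
have [tI gI] := greedyP hI.
have := xgetPex (greedy I) (greedy_extend hIq tI gI).
by rewrite /greedy rev_rcons /= revK => -[].
Qed.

(** Requests released after [t] end the list; deleting them one at a time leaves the motion up to
    [t] intact. This yields onlineness. *)
Lemma greedy_released I t : instance I -> agree (greedy I) (greedy (released t I)) t.
Proof.
elim/last_ind: I => // I q IH hIq.
have /instance_rcons[hI _ le_q] := hIq.
rewrite /released filter_rcons; case: leP => [qt|tq].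
  suff -> : [seq p <- I | release p <= t] = I by [].
  by apply/all_filterP/allP => p /le_q /le_trans; apply.
exact: agree_trans (agreeW (ltW tq) (greedy_rcons hIq)) (IH hI).
Qed.

Lemma greedy_is_GR0 : is_GR0 greedy.
Proof.
split; first split.
- by move=> I /greedyP[].
- move=> I J t hI hJ eIJ s s0 st.
  rewrite (greedy_released (t := t) hI) ?s0// eIJ.
  by rewrite -(greedy_released (t := t) hJ) ?s0.
move=> I hI; have [_ gI] := greedyP hI.
exists (best (greedy I) I); split.
- by move=> t t0 ex; split; [exact: best_heaviest|exact: (gI t t0).1].
- by move=> t t0; exact: (gI t t0).2.
move=> t s t0 ts h; apply: best_keep => //; last by apply: h; rewrite ts lexx.
by exists (best (greedy I) I t); case: (h t _) => //; rewrite lexx ts.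
Qed.

End Greedy.

(** * Performance of greedy motions *)

Section Performance.
Variable R : realType.
Implicit Types (x z : R -> R) (I J : seq (request R)) (p q : request R).

Lemma total_weight_gt0 I : instance I -> (0 < size I)%N ->
  0 < \sum_(q <- I) weight q.
Proof.
move=> hI; case: I hI => // q I hI _; rewrite big_cons ltr_pwDl//.
  by apply: (valid_weight hI); exact: mem_head.
rewrite big_seq; apply: sumr_ge0 => p pI.
by rewrite ltW// (valid_weight hI)// in_cons pI orbT.
Qed.

Lemma performance_ge0 x I : instance I -> 0 <= performance x I.
Proof.
move=> hI; rewrite /performance big_seq_cond [X in _ / X]big_seq.
by apply: divr_ge0; apply: sumr_ge0 => q; [case/andP|]; move=> *;
  apply/ltW/(valid_weight hI).
Qed.

Lemma performance_le1 x I : instance I -> performance x I <= 1.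
Proof.
move=> hI; case: (posnP (size I)) => [/size0nil->|sI].
  by rewrite /performance !big_nil mul0r ler01.
rewrite ler_pdivrMr ?total_weight_gt0// mul1r big_mkcond.
rewrite big_seq [leRHS]big_seq; apply: ler_sum => q qI.
by case: ifP => // _; rewrite ltW// (valid_weight hI).
Qed.

Lemma performance_eq1 x I : instance I -> (0 < size I)%N ->
  {in I, forall q, served x q} -> performance x I = 1.
Proof.
move=> hI sI sv; rewrite /performance.
suff -> : \sum_(q <- I | `[< served x q >]) weight q = \sum_(q <- I) weight q.
  by rewrite divff// gt_eqF// total_weight_gt0.
rewrite big_seq_cond [RHS]big_seq; apply: eq_bigl => q.
by case: (boolP (q \in I)) => //= /sv h; apply/asboolP.
Qed.

Lemma performance_le_OPT x I : instance I -> trajectory x ->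
  performance x I <= performance_OPT I.
Proof.
move=> hI tx; apply: ub_le_sup; last by exists x.
by exists 1 => _ [y _ <-]; exact: performance_le1.
Qed.

Lemma performance_OPT_le1 I : instance I -> performance_OPT I <= 1.
Proof.
move=> hI; apply: ge_sup.
  by exists (performance (fun=> 0) I), (fun=> 0) => //; exact: trajectory_cst0.
by move=> _ [y _ <-]; exact: performance_le1.
Qed.

(** The total weight is at most [size I] times [weight q], and [weight q] is collected. *)
Lemma performance_heaviest x I q : instance I -> q \in I -> served x q ->
  {in I, forall p, weight p <= weight q} -> (size I)%:R^-1 <= performance x I.
Proof.
move=> hI qI sq maxq; have sI : (0 < size I)%N by case: I qI {hI maxq}.
have wq := valid_weight hI qI.
rewrite ler_pdivlMr ?total_weight_gt0// ler_pdivrMl ?ltr0n//.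
rewrite mulr_natl.
apply: (@le_trans _ _ (weight q *+ size I)).
  rewrite -[X in _ *+ X]count_predT -iter_addr_0 -big_const_seq.
  by rewrite big_seq [leRHS]big_seq; apply: ler_sum.
rewrite lerMn2r gtn_eqF//= (big_rem q qI)/= (asboolT sq) lerDl.
rewrite big_seq_cond; apply: sumr_ge0 => p /andP[/mem_rem pI _].
exact/ltW/(valid_weight hI).
Qed.

Lemma performance_served_once x I : (0 < size I)%N -> uniq I ->
  {in I, forall q, weight q = 1} ->
  {in I &, forall p q, served x p -> served x q -> p = q} ->
  performance x I <= (size I)%:R^-1.
Proof.
move=> sI uI w1 once.
have sumE (P : pred (request R)) : \sum_(q <- I | P q) weight q = (count P I)%:R.
  rewrite big_seq_cond (eq_bigr (fun=> 1)) => [|q /andP[/w1]//].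
  by rewrite -big_seq_cond big_const_seq iter_addr_0.
rewrite /performance !sumE count_predT -[leRHS]mul1r ler_wpM2r ?invr_ge0//.
rewrite -size_filter lern1.
case E : [seq q <- I | _] => [//|a [//|b s]].
have uab := filter_uniq (fun q => `[< served x q >]) uI.
have mf c : c \in [:: a, b & s] -> c \in I /\ served x c.
  by rewrite -E mem_filter => /andP[/asboolP sc cI].
have [aI sa] := mf a (mem_head _ _).
have [bI sb] : b \in I /\ served x b by apply: mf; rewrite !in_cons eqxx orbT.
move: uab; rewrite E /= in_cons.
by rewrite (once a b) // eqxx.
Qed.

Lemma ratio_ge0 (ALG : algorithm R) n (r : R) :
  [set performance (ALG I) I / performance_OPT I | I in instances n 0]%classic r ->
  0 <= r.
Proof.
move=> [I [hI _ _] <-]; apply: divr_ge0; first exact: performance_ge0.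
apply: le_trans (performance_le_OPT hI (trajectory_cst0 R)).
exact: performance_ge0.
Qed.

Lemma competitive_ratio_le n (ALG : algorithm R) I : instances n 0 I ->
  competitive_ratio n 0 ALG <= performance (ALG I) I / performance_OPT I.
Proof.
move=> hI; apply: ge_inf; last by exists I.
by exists 0 => r; exact: ratio_ge0.
Qed.

End Performance.

(** * Greedy motions collect at least the fraction 1/n *)

Section LowerBound.
Variable R : realType.
Implicit Types (x z : R -> R) (I J : seq (request R)) (p q : request R).

(** [heads_to] controls only a short time after each instant, so a continuation argument is used:
    the last time up to which [x] follows the straight motion [z] exists by continuity, and could be
    pushed further if it came before arrival. *)
Lemma heading_reaches x r a : trajectory x -> 0 <= r -> -1 <= a <= 1 ->
  (forall s, r <= s < r + `|a - x r| -> heads_to x s a) ->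
  x (r + `|a - x r|) = a.
Proof.
move=> tx r0 a11 hd; set b := r + _.
have rb : r <= b by rewrite lerDl.
pose z := steer x r a.
have tz : trajectory z by exact: steer_trajectory.
have zb : z b = a by rewrite /z steer_arrived// /b addrAC subrr add0r.
pose S := [set s | r <= s <= b /\ agree x z s]%classic.
have Sr : S r.
  split; first by rewrite lexx.
  by move=> s /andP[_ sr]; rewrite /z steer_agree.
have ubS : has_ubound S by exists b => s [/andP[]].
have rS : r <= sup S by exact: ub_le_sup.
have Sb : sup S <= b by apply: ge_sup; [exists r|move=> s [/andP[]]].
have agS : agree x z (sup S).
  apply: agree_closed => // s s0 sS.
  have := sup_adherent (_ : 0 < sup S - s) (conj (ex_intro _ r Sr) ubS).
  rewrite subr_gt0 subKr => /(_ sS)[u [_ agu] su].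
  by apply: agu; rewrite s0 ltW.
have S0 : 0 <= sup S by exact: le_trans rS.
have [Sltb|] := ltP (sup S) b; last first.
  by move=> bS; rewrite agS ?zb// bS andbT (le_trans r0).
have [|e e0 he] := hd (sup S); first by rewrite rS.
pose u := Num.min (sup S + e) b.
have [Su ue ub] : [/\ sup S < u, u <= sup S + e & u <= b].
  by rewrite /u; case: (leP (sup S + e) b) => ?; split; lra.
suff /(ub_le_sup ubS) : S u by rewrite leNgt Su.
split; first by rewrite ub andbT (le_trans rS)// ltW.
move=> s /andP[s0 su]; have [sS|Ss] := leP s (sup S).
  by apply: agS; rewrite s0.
rewrite he ?(ltW Ss) ?(le_trans su)// agS ?S0 ?lexx//.
by rewrite /z [RHS](@steer_step _ _ _ _ (sup S)) ?(ltW Ss)// (le_trans su).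
Qed.

Lemma greedy_motion_serves_heaviest I x : instance I -> (0 < size I)%N ->
  trajectory x -> greedy_motion I x ->
  exists q, [/\ q \in I, served x q & {in I, forall p, weight p <= weight q}].
Proof.
move=> hI sI tx [dest [dest_heaviest _ dest_keep]].
have [|q0 [q0I _ maxq0]] := @seq_argmax R _ (fun=> True) (@weight R) I.
  by exists (nth (0, 0, 0) I 0) => //; exact: mem_nth.
have [|q [qI wq minq]] := @seq_argmax R _ (fun p => weight p = weight q0)
    (fun p => - release p) I; first by exists q0.
have {maxq0 q0I} maxq : {in I, forall p, weight p <= weight q}.
  by move=> p pI; rewrite wq; apply: maxq0.
have {}minq : {in I, forall p, weight p = weight q -> release q <= release p}.
  by move=> p pI wp; rewrite -lerN2 minq// wp.
have r0 := valid_release hI qI; set r := release q in r0 minq.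
have [xq|nxq] := pselect (x r = location q).
  exists q; split => //; exists r => //.
  by rewrite lexx /deadline lerDl ler0n.
have pq : pending x I r q.
  split => //; first by rewrite lexx /deadline ltrDl ltr0n.
  by move=> s /andP[rs sr]; have -> : s = r by apply: le_anti; rewrite sr.
have [[pp hp] _] := dest_heaviest r r0 (ex_intro _ q pq).
set p := dest r in pp hp; have [pI /andP[rp dp] _] := pp.
(* A tie may lead the vehicle to [p] instead of [q]. Being equally heavy, [p] is not released before
   [q], hence exactly at [r], with its whole window ahead. *)
have wp : weight p = weight q.
  by apply: le_anti; rewrite maxq// hp.
have {}rp : release p = r by apply: le_anti; rewrite rp minq.
exists p; split => //; last by move=> p'; rewrite wp; exact: maxq.
apply: contrapT => np.
(* If [p] is never served, it stays pending and heaviest until its deadline, so the vehicle keeps it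
   as destination and reaches it within 2: a contradiction. *)
have pend s : r <= s -> s < deadline p -> heaviest x I s p.
  move=> rs sd; split; last by move=> p' [p'I _ _]; rewrite wp maxq.
  split => //; first by rewrite rp rs.
  move=> u /andP[pu us] xu; apply: np; exists u => //.
  by rewrite pu ltW// (le_lt_trans us).
have a11 := valid_location hI pI.
have d2 : `|location p - x r| <= 2.
  have := trajectory_bound tx r0; rewrite ler_norml.
  by case/andP: a11 => ? ? /andP[? ?]; apply/andP; split; lra.
have dl : deadline p = r + 2 by rewrite /deadline rp.
apply: np; exists (r + `|location p - x r|).
  by rewrite rp dl lerDl normr_ge0 lerD2l.
apply: heading_reaches => // s /andP[rs sd].
have sdl : s < deadline p by rewrite dl (lt_le_trans sd)// lerD2l.
have s0 := le_trans r0 rs.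
have [_] := dest_heaviest s s0 (ex_intro _ p (pend s rs sdl).1).
rewrite (dest_keep r s)// => u /andP[ru us].
by apply: pend => //; exact: le_lt_trans sdl.
Qed.

Lemma GR0_ratio_ge (GR0 : algorithm R) n I : is_GR0 GR0 -> instances n 0 I ->
  n%:R^-1 <= performance (GR0 I) I / performance_OPT I.
Proof.
move=> [[tr _] gr] [hI _ /andP[sI In]].
have [q [qI sq maxq]] :=
  greedy_motion_serves_heaviest hI sI (tr I hI) (gr I hI).
have ge := performance_heaviest hI qI sq maxq.
have le := performance_le_OPT hI (tr I hI).
have pos : 0 < performance (GR0 I) I by apply: lt_le_trans ge; rewrite invr_gt0 ltr0n.
apply: (@le_trans _ _ (performance (GR0 I) I)).
  by apply: le_trans ge; rewrite lef_pV2 ?posrE ?ltr0n ?ler_nat// (leq_trans sI).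
rewrite ler_peMr ?(ltW pos)// invf_ge1 ?performance_OPT_le1//.
exact: lt_le_trans le.
Qed.

End LowerBound.

(** * The adversary *)

Section Adversary.
Variables (R : realType) (n : nat) (ALG : algorithm R).
Hypotheses (n_gt0 : (0 < n)%N) (onALG : online ALG).
Implicit Types (x z : R -> R) (I J : seq (request R)) (p q : request R).

(** The released lists coincide only before [release q]; continuity adds that instant, so the
    adversary knows where [ALG] is when [q] appears. *)
Lemma online_rcons I q : instance (rcons I q) ->
  agree (ALG (rcons I q)) (ALG I) (release q).
Proof.
move=> hIq; have /instance_rcons[hI _ _] := hIq; case: onALG => tr on.
apply: agree_closed => [||s s0 sq]; [exact: tr|exact: tr|].
apply: (on _ _ s) => //.
by rewrite /released filter_rcons leNgt sq.
Qed.

(* The requests [I], with [q] the latest one, are all released by time [t].  By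
   [duel_once], [ALG] can no longer serve two of them whatever it does after
   [t]; [z] serves them all and is done at time [v], at [location q].
   [duel_late] keeps [z] early enough to serve at time [v + 2] a request
   released at the opposite end when [ALG] is about to reach [location q]; its
   last term absorbs the small anticipation of each release. *)
Record duel I q t z v : Prop := Duel {
  duel_instance : instance I;
  duel_uniq : uniq I;
  duel_weight : {in I, forall p, weight p = 1};
  duel_ends : {in I, forall p, location p = 1 \/ location p = -1};
  duel_release : {in I, forall p, release p <= t};
  duel_last : q \in I;
  duel_unserved : {in I, forall p s, release p <= s <= deadline p -> s <= t ->
    ALG I s <> location p};
  duel_once : forall x, trajectory x -> agree x (ALG I) t ->
    {in I &, forall p p', served x p -> served x p' -> p = p'};
  duel_offline : trajectory z;
  duel_turn : z v = location q;
  duel_before : t <= v;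
  duel_offline_serves : {in I, forall p, exists s,
    [/\ release p <= s <= deadline p, s <= v & z s = location p]};
  duel_other_end : {in I, forall p, location p <> location q -> deadline p <= v};
  duel_late : v <= t + `|ALG I t - location q| - 1 + (size I)%:R / n%:R
}.

Lemma duel_start : exists I q t z v, duel I q t z v /\ size I = 1%N.
Proof.
have [tr _] := onALG; have i0 : instance (Nil (request R)) by [].
(* The first request appears at time 1 at an end at distance at least 1 from [ALG]; the offline
   vehicle leaves at time 0 and is there exactly then. *)
pose e : R := if ALG [::] 1 <= 0 then 1 else -1.
have [e1 de] : (e = 1 \/ e = -1) /\ 1 <= `|ALG [::] 1 - e|.
  by rewrite /e ler_normr; case: (leP (ALG [::] 1) 0) => ?; split;
    [left| |right| ]; rewrite //; apply/orP; [right|left]; lra.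
pose q : request R := (e, 1, 1).
have vq : valid_request q.
  by rewrite /valid_request /=; apply/and4P; rewrite /location /release /weight /=;
    case: e1 => ->; split; lra.
have iq : instance (rcons [::] q) by apply/instance_rcons.
have ag : agree (ALG [:: q]) (ALG [::]) 1 by exact: (@online_rcons [::] q).
have t0 : trajectory (steer (fun=> 0) 0 e).
  by apply: steer_trajectory => //; [exact: trajectory_cst0|case: e1 => ->; lra].
have z1 : steer (fun=> 0) 0 e 1 = e.
  by rewrite steer_arrived// ler_norml; case: e1 => ->; lra.
have inq p : p \in [:: q] -> p = q by rewrite inE => /eqP.
exists [:: q], q, 1, (steer (fun=> 0) 0 e), 1; split => //; split => //.
- by move=> p /inq->.
- by move=> p /inq->.
- by move=> p /inq->; exact: lexx.
- exact: mem_head.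
- move=> p /inq-> s /andP[s1 _] s2.
  have {s1 s2}-> : s = 1 by apply: le_anti; rewrite s2.
  rewrite ag; last by rewrite ler01 lexx.
  by move=> E; move: de; rewrite E /= subrr normr0 lt_geF// ltr01.
- by move=> x _ _ p p' /inq-> /inq->.
- move=> p /inq->; exists 1; split => //.
  by rewrite /release /deadline /= lexx lerDl ler0n.
- by move=> p /inq->.
- rewrite ag ?ler01 ?lexx//= /location /=.
  have : 0 <= 1%:R / n%:R :> R by rewrite divr_ge0 ?ler0n.
  by lra.
Qed.

(* The new request is released at the end opposite to [p], a tiny time [eta]
   before [ALG] serves [p].  The two ends are 2 apart, so serving [p] makes the
   new request unreachable, while turning round loses [p] and finds every
   request of the opposite end released before [t] expired. *)
Lemma duel_step I q t z v p : duel I q t z v -> (size I < n)%N -> p \in I ->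
  served (ALG I) p ->
  exists q' t' z' v', duel (rcons I q') q' t' z' v'.
Proof.
move=> d sIn pI sp; have [tr _] := onALG.
have hI := duel_instance d; have tx := tr I hI; set x := ALG I in sp tx.
have t0 : 0 <= t.
  exact: le_trans (valid_release hI pI) (duel_release d pI).
have [s0 [/andP[ps0 s0d] xs0 first]] := first_service tx (valid_release hI pI) sp.
have ts0 : t < s0.
  rewrite ltNge; apply/negP => s0t.
  by apply: (duel_unserved d pI _ s0t xs0); rewrite ps0.
have pt := duel_release d pI; set e := location p in xs0 first.
have e1 : e = 1 \/ e = -1 by exact: (duel_ends d pI).
have dist0 : 0 < `|x t - e|.
  rewrite normr_gt0 subr_eq0; apply/eqP => xt.
  by apply: (duel_unserved d pI _ (lexx t) xt); rewrite pt ltW// (lt_le_trans ts0).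
have dist_s0 : t + `|x t - e| <= s0.
  have [] := trajectory_lip tx t0 (ltW ts0); rewrite xs0 => ? ?.
  by rewrite -lerBrDl ler_norml; apply/andP; split; lra.
have N0 : 0 < n%:R :> R by rewrite ltr0n.
(* The bound by the distance gives [t' - t >= 3 * eta], enough for old requests at the other end to
   expire before they can be reached; the bound by 1/n pays for the loss of [2 * eta] in
   [duel_late]. *)
have [eta [eta0 eta_dist eta_n]] : exists eta : R,
    [/\ 0 < eta, 4 * eta <= `|x t - e| & 2 * eta <= n%:R^-1].
  have i0 : 0 < n%:R^-1 :> R by rewrite invr_gt0.
  exists (Num.min (`|x t - e| / 4) (n%:R^-1 / 2)).
  by case: (leP (`|x t - e| / 4) (n%:R^-1 / 2)) => ?; split; lra.
have n1 : n%:R^-1 <= 1 :> R by rewrite invf_le1 ?ler1n.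
have bt := trajectory_bound tx t0.
have dist2 : `|x t - e| <= 2.
  by rewrite ler_norml; case: e1 => ->; move: bt => /andP[? ?]; apply/andP; split; lra.
pose t' := s0 - eta; have tt' : t < t' by rewrite /t'; lra.
have t'0 : 0 <= t' by lra.
have bt' := trajectory_bound tx t'0.
have near : `|x t' - e| <= eta.
  have [] := trajectory_lip tx t'0 (_ : t' <= s0); first by rewrite /t'; lra.
  by rewrite xs0 ler_norml /t' => ? ?; apply/andP; split; lra.
have not_at_e : x t' <> e by apply: first; rewrite /t'; apply/andP; split; lra.
pose b : request R := (- e, t', 1).
have ib : instance (rcons I b).
  apply/instance_rcons; split => //.
    by rewrite /valid_request /location /release /weight /=; apply/and4P;
      case: e1 => ->; split; lra.
  by move=> c cI; rewrite (le_trans (duel_release d cI))// ltW.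
have ag : agree (ALG (rcons I b)) x t' by exact: (online_rcons ib).
(* Since [x] serves [p], [duel_once] forbids any other service, and [p] is first served at
   [s0 > t']. *)
have old c s : c \in I -> release c <= s <= deadline c -> s <= t' ->
    x s <> location c.
  move=> cI cs st' xs.
  have E : c = p.
    by apply: (duel_once d tx _ cI pI _ sp) => //; exists s.
  move: cs xs; rewrite E => /andP[cs _]; apply: first; rewrite cs /=.
  by rewrite (le_lt_trans st')// /t'; lra.
have inb c : c \in rcons I b -> c = b \/ c \in I.
  by rewrite mem_rcons in_cons => /orP[/eqP|]; [left|right].
have bnotin : b \notin I.
  by apply/negP => /(duel_release d); rewrite leNgt tt'.
have never x' c : trajectory x' -> agree x' x t' -> c \in I ->
    served x' c -> served x' b -> False.
  move=> tx' ag' cI [s1 /andP[cs1 s1d] xs1] [s2 /andP[bs2 s2d] xs2].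
  rewrite /deadline /release /location /= in bs2 s2d xs2.
  have rc := duel_release d cI; rewrite /deadline in s1d.
  have s10 := le_trans (valid_release hI cI) cs1.
  have t's1 : t' <= s1.
    rewrite leNgt; apply/negP => lt_s1.
    apply: (old c s1) => //; first by rewrite cs1.
      exact: ltW.
    by rewrite -ag'// s10 ltW.
  have xt' : x' t' = x t' by rewrite ag' ?t'0 ?lexx.
  have [l1 l1'] := trajectory_lip tx' t'0 t's1.
  have [l2 l2'] := trajectory_lip tx' t'0 bs2.
  rewrite xt' xs1 in l1 l1'; rewrite xt' xs2 in l2 l2'.
  move: near not_at_e; rewrite ler_norml => /andP[near1 near2] /eqP not_at_e.
  have [ce|ce] : location c = e \/ location c = - e.
    by have := duel_ends d cI; case: e1 => -> [] ->; rewrite ?opprK; auto.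
  (* Reaching [e] takes positive time and crossing takes 2 more, past the deadline of [b]; in the
     other order [c] has expired. *)
  - rewrite ce in xs1 l1 l1'.
    have [s12|s21] := leP s1 s2.
      have [l3 l3'] := trajectory_lip tx' s10 s12.
      rewrite xs1 xs2 in l3 l3'.
      move: not_at_e bt'; rewrite neq_lt => /orP[lt|lt] /andP[? ?];
        by case: e1 => E; rewrite E in l1 l1' l2 l2' l3 l3' near1 near2 lt; lra.
    have [l3 l3'] := trajectory_lip tx' (le_trans t'0 bs2) (ltW s21).
    rewrite xs1 xs2 in l3 l3'.
    by case: e1 => E; rewrite E in l1 l1' l2 l2' l3 l3' near1 near2; lra.
  (* From near [e], reaching [- e] takes at least [2 - eta], but [c] expires by [t + 2]. *)
  - rewrite ce in l1 l1'; rewrite /t' in l1 l1' near1 near2 tt'.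
    by case: e1 => E; rewrite E in l1 l1' near1 near2; lra.
have far : 2 - eta <= `|ALG (rcons I b) t' - - e|.
  rewrite ag ?t'0 ?lexx// opprK; move: near; rewrite ler_norml ler_normr.
  move=> /andP[near1 near2]; apply/orP.
  by case: e1 => E; [left|right]; rewrite E in near1 near2 *; lra.
have szE : (size (rcons I b))%:R / n%:R = (size I)%:R / n%:R + n%:R^-1 :> R.
  by rewrite size_rcons -natr1 mulrDl mul1r.
(* The accumulated slack stays at most 1, so the offline vehicle reaches [b] by its deadline
   [t' + 2]. *)
have sz1 : (size I)%:R / n%:R + n%:R^-1 <= 1 :> R.
  by rewrite -szE ler_pdivrMr// mul1r ler_nat size_rcons.
have late := duel_late d; have tv := duel_before d; rewrite -/x in late.
set k := (size I)%:R / n%:R in szE sz1 late.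
have [z' [v' [[tz' z'v' t'v' v't' z'z] [other late']]]] : exists z' v',
  [/\ trajectory z', z' v' = - e, t' <= v', v' <= t' + 2
    & {in I, forall c, exists s,
        [/\ release c <= s <= deadline c, s <= v' & z' s = location c]}] /\
    {in I, forall c, location c <> - e -> deadline c <= v'} /\
    v' <= t' + 1 - eta + (k + n%:R^-1).
  (* If [z] turns at [e], it crosses the segment and reaches [b] at time [v + 2], after the
     deadlines of all old requests. *)
  have [qe|/eqP qe] := eqVneq (location q) e.
    exists (steer z v (- e)), (v + 2).
    have v0 : 0 <= v by exact: le_trans tv.
    rewrite qe in late; rewrite /deadline in s0d.
    have zv' : steer z v (- e) (v + 2) = - e.
      rewrite steer_arrived// (duel_turn d) qe ler_norml.
      by case: e1 => ->; apply/andP; split; lra.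
    split; split => //.
    - apply: steer_trajectory => //; first exact: (duel_offline d).
      by case: e1 => ->; apply/andP; split; lra.
    - by rewrite /t'; lra.
    - by rewrite /t'; lra.
    - move=> c /(duel_offline_serves d)[s [cs sv zs]]; exists s; split => //.
        by lra.
      by rewrite steer_agree.
    - by move=> c /(duel_release d) ct _; rewrite /deadline; lra.
    - by rewrite /t'; lra.
  (* Otherwise [z] is at [- e] at time [v]. As [p] lies at the other end, [duel_other_end] gives
     [s0 <= v], so the same visit serves [b]. *)
  have qne : location q = - e.
    have := duel_ends d (duel_last d).
    by case: e1 qe => -> qe [] E; rewrite E ?opprK// in qe *.
  have t'v : t' <= v.
    have := duel_other_end d pI; rewrite -/e => /(_ (nesym qe)).
    by rewrite /t'; lra.
  have dist2' : `|x t - location q| <= 2.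
    by rewrite qne ler_norml; case: e1 => ->; move: bt => /andP[? ?];
      apply/andP; split; lra.
  exists z, v; split; split => //; try exact: (duel_offline d).
  - by rewrite (duel_turn d).
  - by rewrite /t' in tt' *; lra.
  - exact: (duel_offline_serves d).
  - by move=> c cI; rewrite -qne; exact: (duel_other_end d).
  - by rewrite /t' in tt' *; lra.
exists b, t', z', v'.
have b_last : b \in rcons I b by rewrite mem_rcons mem_head.
split => //.
- by rewrite rcons_uniq bnotin (duel_uniq d).
- by move=> c /inb[->//|/(duel_weight d)].
- move=> c /inb[->|/(duel_ends d)//]; rewrite /location /=.
  by case: e1 => ->; [right|left; rewrite opprK].
- by move=> c /inb[->|/(duel_release d)cI]; [exact: lexx|exact: le_trans (ltW tt')].
- move=> c cI s cs st'; have s0' : 0 <= s.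
    by case/andP: cs => + _; apply: le_trans; exact: valid_release ib cI.
  rewrite ag ?s0'//; case: (inb c cI) cs => [->|{}cI] cs; last exact: old.
  case/andP: cs => bs _; have -> : s = t' by apply: le_anti; rewrite st'.
  move: near; rewrite /location /= ler_norml => /andP[near1 near2].
  by case: e1 => E; rewrite E in near1 near2 *; lra.
- move=> x' tx' ag' c c' /inb[->|cI] /inb[->|c'I] // sc sc'.
  + by case: (never x' c' tx' (agree_trans ag' ag)).
  + by case: (never x' c tx' (agree_trans ag' ag)).
  have ag'' := agree_trans ag' ag.
  exact: (duel_once d tx' (agreeW (ltW tt') ag'')).
- move=> c /inb[->|/z'z//]; exists v'; split => //.
  by rewrite /deadline /release /= t'v'.
- by move=> c /inb[->//|/other].
- by rewrite szE; lra.
Qed.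

(** Either [ALG] serves nothing in some duel, or [duel_step] extends duels until there are n
    requests, of which [duel_once] allows one service. In both cases [z] serves everything. *)
Lemma adversary : exists I, [/\ instances n 0 I,
  performance_OPT I = 1 & performance (ALG I) I <= n%:R^-1].
Proof.
have [tr _] := onALG.
apply: contrapT => unbeaten.
have OPT1 I q t z v : duel I q t z v -> (0 < size I)%N -> performance_OPT I = 1.
  move=> d sI; have hI := duel_instance d.
  apply: le_anti; rewrite performance_OPT_le1//=.
  rewrite -(performance_eq1 hI sI (x := z)); last first.
    by move=> c /(duel_offline_serves d)[s [cs _ zs]]; exists s.
  exact: performance_le_OPT (duel_offline d).
have progress k : (k < n)%N ->
    exists I q t z v, duel I q t z v /\ size I = k.+1.
  elim: k => [_|k IH kn]; first exact: duel_start.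
  have [I [q [t [z [v [d sI]]]]]] := IH (ltnW kn).
  have [[p pI sp]|none] := pselect (exists2 p, p \in I & served (ALG I) p).
    have [|q' [t' [z' [v' d']]]] := duel_step d _ pI sp; first by rewrite sI.
    by exists (rcons I q'), q', t', z', v'; rewrite size_rcons sI.
  have hI := duel_instance d.
  case: unbeaten; exists I; split.
  - by split => //; [case: hI|rewrite sI /= ltnW].
  - by apply: (OPT1 _ _ _ _ _ d); rewrite sI.
  rewrite /performance big_seq_cond big1 ?mul0r ?invr_ge0// => c.
  by move=> /andP[cI /asboolP sc]; case: none; exists c.
have [|I [q [t [z [v [d sI]]]]]] := progress n.-1; first by rewrite prednK.
rewrite prednK// in sI; have hI := duel_instance d.
case: unbeaten; exists I; split.
- by split => //; [case: hI|rewrite sI n_gt0 /=].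
- by apply: (OPT1 _ _ _ _ _ d); rewrite sI.
rewrite -sI; apply: performance_served_once; first by rewrite sI.
- exact: (duel_uniq d).
- exact: (duel_weight d).
exact: (duel_once d (tr I hI)).
Qed.

Lemma competitive_ratio_upper : competitive_ratio n 0 ALG <= n%:R^-1.
Proof.
have [I [hI OPT1 perf]] := adversary.
by apply: le_trans (competitive_ratio_le ALG hI) _; rewrite OPT1 divr1.
Qed.

End Adversary.

Theorem theorem1 (R : realType) (n : nat) (hn : (1 <= n)%N) :
  (exists GR0 : algorithm R, is_GR0 GR0) /\
  (forall GR0 : algorithm R, is_GR0 GR0 ->
     [/\ optimal n 0 GR0,
         best_ratio R n 0 = competitive_ratio n 0 GR0
       & competitive_ratio n 0 GR0 = 1 / n%:R]).
Proof.
split=> [|GR0 gr0]; first by exists (@greedy R); exact: greedy_is_GR0.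
have [on _] := gr0.
have ratioE : competitive_ratio n 0 GR0 = n%:R^-1.
  apply: le_anti; rewrite competitive_ratio_upper//=.
  have [I [hI _ _]] := adversary hn on.
  apply: lb_le_inf; first by exists (performance (GR0 I) I / performance_OPT I), I.
  by move=> _ [J hJ <-]; exact: GR0_ratio_ge.
have bestE : best_ratio R n 0 = n%:R^-1.
  have ub : ubound [set competitive_ratio n 0 ALG | ALG in @online R]%classic n%:R^-1.
    by move=> _ [ALG onALG <-]; exact: competitive_ratio_upper.
  apply: le_anti; apply/andP; split.
    by apply: ge_sup => //; exists (competitive_ratio n 0 GR0), GR0.
  by apply: ub_le_sup; [exists n%:R^-1|exists GR0].
by rewrite /optimal bestE ratioE div1r.
Qed.
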